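(* Let $d_1,\dots,d_n$ be positive integers, let $d=\operatorname{lcm}(d_1,\dots,d_n)$, and let $\mathfrak d=\langle x_1^{d_1},\dots,x_n^{d_n}\rangle\subset R$. Suppose $p>nd-n$ and $p\nmid d$. Let $\mathbf u\in\mathbb N^n$ be a point with all coordinates positive such that $\lambda=\operatorname{crit}(\mathfrak d,\mathbf u)<1$. Let $\mathcal A$ be the set of all $\mathbf v\in\mathbb N^n$ satisfying $\operatorname{crit}(\mathfrak d,\mathbf v+\mathbf 1)>\operatorname{crit}(\mathfrak d,\mathbf u)$ and $\deg(\mathbf v+\mathbf 1)=\deg(\mathbf u)$, and let $\mathfrak a$ be the ideal of $R$ generated by all monomials $x^{\mathbf v}$ with $\mathbf v\in\mathcal A$. Then $$\mathfrak d^{[\lambda]}=R_{>\deg(\mathbf u-\mathbf 1)}+\mathfrak a.$$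
   Context: $p$ is a prime, $\Bbbk$ is a field of characteristic $p$ with $[\Bbbk:\Bbbk^p]<\infty$, $n\ge1$, $R=\Bbbk[x_1,\dots,x_n]$, $\mathbf 1=(1,\dots,1)$. For $\mathbf v\in\mathbb N^n$, $x^{\mathbf v}=x_1^{v_1}\cdots x_n^{v_n}$ and $\deg(\mathbf v)=\sum_i dv_i/d_i$. For $m\in\mathbb N$, $R_{>m}=\langle x^{\mathbf v}:\deg(\mathbf v)>m\rangle$; in particular $R_{>\deg(\mathbf u-\mathbf 1)}=\langle x^{\mathbf v}:\deg(\mathbf v+\mathbf 1)>\deg(\mathbf u)\rangle$. For $\mathbf u\in\mathbb N^n$ with positive coordinates, $\operatorname{diag}(\mathbf u)=\langle x_1^{u_1},\dots,x_n^{u_n}\rangle$. Frobenius powers. Let $\mathfrak c$ be a nonzero proper ideal of $R$. For an ideal $\mathfrak b$ and $e\ge0$, $\mathfrak b^{[p^e]}=\langle f^{p^e}:f\in\mathfrak b\rangle$, and $\mathfrak b^{[1/p^e]}$ is the smallest ideal whose $[p^e]$-th power contains $\mathfrak b$. If $m\in\mathbb N$ has base $p$ expansion $m=m_0+m_1p+\cdots+m_rp^r$, then $\mathfrak c^{[m]}=\mathfrak c^{m_0}(\mathfrak c^{m_1})^{[p]}\cdots(\mathfrak c^{m_r})^{[p^r]}$. For $t=m/p^e$ with $m\in\mathbb N$, $\mathfrak c^{[t]}=(\mathfrak c^{[m]})^{[1/p^e]}$. For real $t\ge0$, $\mathfrak c^{[t]}=\bigcup_k\mathfrak c^{[t_k]}$,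 where $(t_k)$ is any sequence of rational numbers whose denominators are powers of $p$ converging to $t$ monotonically from above (the union equals $\mathfrak c^{[t_k]}$ for $k\gg0$). For a nonzero proper ideal $\mathfrak c$ and a proper ideal $\mathfrak b$ with $\mathfrak c\subseteq\sqrt{\mathfrak b}$, and $q=p^e$, $\mu(\mathfrak c,\mathfrak b,q)=\max\{m\in\mathbb N:\mathfrak c^{[m]}\not\subseteq\mathfrak b^{[q]}\}$ and $\operatorname{crit}(\mathfrak c,\mathfrak b)=\lim_{q\to\infty}\mu(\mathfrak c,\mathfrak b,q)/q$ (the limit exists, and equals $\min\{t>0:\mathfrak c^{[t]}\subseteq\mathfrak b\}$). We write $\operatorname{crit}(\mathfrak c,\mathbf u)$ for $\operatorname{crit}(\mathfrak c,\operatorname{diag}(\mathbf u))$. *)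

(* Defs.v *)
From HB Require Import structures.
From mathcomp Require Import all_boot all_order all_algebra.
From mathcomp Require Import all_classical all_reals all_analysis.
From mathcomp Require Import (coercions, canonicals) mpoly.

Set Implicit Arguments.
Unset Strict Implicit.
Unset Printing Implicit Defensive.

Import Order.TTheory GRing.Theory Num.Theory.
Import numFieldNormedType.Exports.

Local Open Scope classical_set_scope.
Local Open Scope ring_scope.

Section Ideals.
Variable A : comNzRingType.
Implicit Types (I J b c : set A) (p e m q : nat).

Definition is_ideal I : Prop :=
  [/\ I 0, (forall f g, I f -> I g -> I (f + g))
    & (forall r f, I f -> I (r * f))].

Definition ideal_gen (S : set A) : set A := smallest is_ideal S.

Definition ideal_add I J : set A := [set f + g | f in I & g in J].

Definition ideal_mul I J : set A := ideal_gen [set f * g | f in I & g in J].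

Definition ideal_exp I m : set A := iter m (ideal_mul I) setT.

(* b^[q], for q a power of the characteristic *)
Definition frob_pow b q : set A := ideal_gen [set f ^+ q | f in b].

(* b^[1/q], the least ideal J with b `<=` J^[q], as the intersection of all
   such J; over a polynomial ring the intersection is itself such a J. *)
Definition frob_root b q : set A :=
  \bigcap_(J in [set J | is_ideal J /\ b `<=` frob_pow J q]) J.

(* c^[m]: the i-th base p digit of m is (m %/ p ^ i) %% p. The digits of index
   i > m vanish (as i < p ^ i), and a zero digit contributes the unit ideal. *)
Definition frob_npow p c m : set A :=
  \big[ideal_mul/setT]_(i < m.+1)
    frob_pow (ideal_exp c ((m %/ p ^ i) %% p)%N) (p ^ i)%N.

(* c^[m / p^e] *)
Definition frob_qpow p c m e : set A := frob_root (frob_npow p c m) (p ^ e)%N.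

(* mu(c, b, p^e), with value 0 if the maximum does not exist. *)
Definition mu p c b e : nat :=
  xget 0%N [set m | ~ (frob_npow p c m `<=` frob_pow b (p ^ e)%N) /\
    forall m', ~ (frob_npow p c m' `<=` frob_pow b (p ^ e)%N) -> (m' <= m)%N].

Variable R : realType.

Definition padic_frac p m e : R := m%:R / (p ^ e)%N%:R.

Definition crit p c b : R := limn (fun e => padic_frac p (mu p c b e) e).

(* t_k = m_k / p^(e_k) converges to t monotonically from above. *)
Definition approx_above p (t : R) (m e : nat -> nat) : Prop :=
  nonincreasing_seq (fun k => padic_frac p (m k) (e k)) /\
  (fun k => padic_frac p (m k) (e k)) @ \oo --> t.

(* c^[t] for real t: the common value of the unions of the c^[t_k] over all
   admissible sequences (t_k). If these unions did not agree, the value would be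
   the junk set0; so an equation between frob_rpow and an ideal asserts the
   independence of the sequence as well. *)
Definition frob_rpow p c (t : R) : set A :=
  xget set0 [set I | forall m e : nat -> nat, approx_above p t m e ->
                       I = \bigcup_k frob_qpow p c (m k) (e k)].

End Ideals.

(* [k : k^p] < oo *)
Definition F_finite (k : fieldType) (p : nat) : Prop :=
  exists (r : nat) (b : 'I_r -> k),
    forall x : k, exists a : 'I_r -> k, x = \sum_(i < r) a i ^+ p * b i.

Section Monomials.
Variables (k : fieldType) (n : nat).
Implicit Types (u v : mpoly.multinom n) (d : 'I_n -> nat).

Definition mnm_one : mpoly.multinom n := mpoly.Multinom [tuple 1%N | i < n].

Definition monomial_ideal (S : set (mpoly.multinom n)) : set (mpoly.mpoly n k) :=
  ideal_gen [set mpoly.mpolyX k v | v in S].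

(* diag(w) = <x_1^(w_1), ..., x_n^(w_n)> *)
Definition diag_ideal (w : 'I_n -> nat) : set (mpoly.mpoly n k) :=
  ideal_gen [set mpoly.mpolyX k (mpoly.mnm1 i) ^+ w i | i in [set: 'I_n]].

Definition lcm_exp d : nat := \big[lcmn/1%N]_(i < n) d i.

(* deg(v) = sum_i D v_i / d_i with D = lcm(d); the division is exact. *)
Definition wdeg d v : nat := (\sum_(i < n) (lcm_exp d * v i) %/ d i)%N.

Definition R_gt d (m : nat) : set (mpoly.mpoly n k) :=
  monomial_ideal [set v | (m < wdeg d v)%N].

End Monomials.

Arguments mnm_one : clear implicits.
Arguments monomial_ideal k {n} S _.
Arguments diag_ideal k {n} w _.
Arguments R_gt k {n} d m _.

(* Main.v *)
Require Import Defs.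
From mathcomp Require Import all_boot all_order all_algebra.
From mathcomp Require Import all_classical all_reals all_analysis.
From mathcomp Require Import (coercions, canonicals) mpoly.
From mathcomp Require Import -(notations) mpoly.
From mathcomp Require Import ring zify.

(* The ideal d^[m] is generated by the x^(d h) with h in N^n of sum m whose
   entries add up without carries in base p, and b^[1/q] of a monomial ideal b
   is obtained by dividing exponents by q, rounding down (apply a Frobenius
   splitting coefficientwise). Hence crit(d, w) is the supremum, never attained,
   of the fractions |h|/p^e over the carry-free h with d_i h_i < w_i p^e for all
   i, and x^v lies in d^[t] if and only if crit(d, v + 1) > t.
   One always has crit(d, w) <= deg(w)/d. Conversely, if x < 1 and
   d x <= deg(w) - 1 then x < crit(d, w): consider the largest exponents h
   allowed by w at the level q = p. If they carry, then crit(d, w) >= 1; if not,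
   then p > nd - n bounds the rounding errors, and d |h| >= p (deg(w) - 1). So if
   deg(w) < deg(w'), then any x < 1 with x <= crit(d, w) satisfies
   x < crit(d, w'), and only the monomials with deg(v + 1) = deg(u) have to be
   singled out by their critical exponents. *)

Import Order.TTheory GRing.Theory Num.Theory.
Import numFieldNormedType.Exports.

Set Implicit Arguments.
Unset Strict Implicit.
Unset Printing Implicit Defensive.

Local Open Scope classical_set_scope.
Local Open Scope ring_scope.

(** * Sums without carries *)

Section NoCarry.
Local Open Scope nat_scope.
Variables (p n : nat).
Implicit Types (h a : 'I_n -> nat).

(* The entries of h add up without carries in base p; by Legendre's formula, for
   p prime, this means that p does not divide their multinomial coefficient. *)
Definition no_carry h : Prop :=
  forall j, \sum_i h i %/ p ^ j = (\sum_i h i) %/ p ^ j.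

Lemma sum_single (i0 : 'I_n) c : \sum_i (if i == i0 then c else 0) = c.
Proof. by rewrite -big_mkcond big_pred1_eq. Qed.

Lemma no_carry_single (i0 : 'I_n) c :
  no_carry (fun i => if i == i0 then c else 0).
Proof.
move=> j; rewrite sum_single -[RHS](sum_single i0).
by apply: eq_bigr => i _; case: ifP; rewrite ?div0n.
Qed.

Lemma leq_sum_fun h (i : 'I_n) : h i <= \sum_i h i.
Proof. by rewrite (bigD1 i) //= leq_addr. Qed.

(** Raise one entry at a time: while the total is below that of [a], some entry still has room. This
    later trims exponents that carry to the total p - 1. *)
Lemma exists_leq_sum a m : m <= \sum_i a i ->
  exists b : 'I_n -> nat, (\sum_i b i)%N = m /\ forall i, (b i <= a i)%N.
Proof.
elim: m => [|m IH lt_m]; first by exists (fun=> 0%N); rewrite big1.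
have [b [bm le_b]] := IH (ltnW lt_m).
have [i lt_bi] : exists i, (b i < a i)%N.
  apply/existsP/contraT; rewrite negb_exists => /forallP ge_b.
  by move: lt_m; rewrite -bm ltnNge leq_sum // => i _; rewrite leqNgt ge_b.
exists (fun j => b j + (if j == i then 1 else 0))%N; split=> [|j].
  by rewrite big_split /= sum_single bm addn1.
by case: eqP => [->|_]; rewrite ?addn1 ?addn0.
Qed.

Hypothesis p_prime : prime p.
Let p_gt0 : 0 < p. Proof. exact: prime_gt0. Qed.
Let p_gt1 : 1 < p. Proof. exact: prime_gt1. Qed.
Let pX_gt0 e : 0 < p ^ e. Proof. by rewrite expn_gt0 p_gt0. Qed.

Lemma no_carry_small a : \sum_i a i < p -> no_carry a.
Proof.
move=> lt_ap [|j]; first by rewrite divn1; apply: eq_bigr => i _; rewrite divn1.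
have ltj : \sum_i a i < p ^ j.+1.
  by rewrite (leq_trans lt_ap) // -{1}[p]expn1 leq_exp2l.
rewrite divn_small // big1 // => i _; rewrite divn_small //.
exact: leq_ltn_trans (leq_sum_fun a i) ltj.
Qed.

(** The entries of [a] and their sum use only digit positions below s, the multiples of p ^ s only
    those from s on, so the two blocks do not interact. *)
Lemma no_carryD s h a : no_carry h -> no_carry a -> \sum_i a i < p ^ s ->
  no_carry (fun i => p ^ s * h i + a i).
Proof.
move=> ch ca lt_as j; rewrite big_split -big_distrr /=.
case: (leqP j s) => [le_js|/ltnW le_sj].
  have E x y : (p ^ s * x + y) %/ p ^ j = p ^ (s - j) * x + y %/ p ^ j.
    by rewrite -{1}(subnK le_js) expnD mulnAC divnMDl.
  rewrite E -ca big_distrr /= -big_split /=.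
  by apply: eq_bigr => i _; rewrite E.
have E x y : y < p ^ s -> (p ^ s * x + y) %/ p ^ j = x %/ p ^ (j - s).
  move=> lt_ys; rewrite -{1}(subnKC le_sj) expnD divnMA mulnC divnMDl //.
  by rewrite (divn_small lt_ys) addn0.
rewrite E // -ch; apply: eq_bigr => i _; rewrite E //.
exact: leq_ltn_trans (leq_sum_fun a i) lt_as.
Qed.

Lemma no_carry_divn s h : no_carry h -> no_carry (fun i => h i %/ p ^ s).
Proof.
move=> ch j; rewrite ch -divnMA -expnD -ch.
by apply: eq_bigr => i _; rewrite -divnMA -expnD.
Qed.

Lemma no_carry_modn s h : no_carry h ->
  \sum_i h i %% p ^ s = (\sum_i h i) %% p ^ s.
Proof.
move=> ch; apply/eqP; rewrite -(eqn_add2l ((\sum_i h i) %/ p ^ s * p ^ s)).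
rewrite -divn_eq -ch big_distrl -big_split /=; apply/eqP.
by apply: eq_bigr => i _; rewrite -divn_eq.
Qed.

(** The residues modulo p ^ s add up to the residue of the total, which is 0, so all of them
    vanish. *)
Lemma no_carry_dvdn s h : no_carry h -> p ^ s %| \sum_i h i ->
  forall i, p ^ s %| h i.
Proof.
move=> ch; rewrite /dvdn -no_carry_modn // sum_nat_eq0 => /forallP h0 i.
exact: h0.
Qed.

(* Decrement an entry with the same p-adic valuation as the total: by divnS,
   each floor on the left drops exactly when the one on the right does. *)
Lemma no_carry_pred m h : no_carry h -> \sum_i h i = m.+1 ->
  exists h', [/\ no_carry h', \sum_i h' i = m & forall i, h' i <= h i].
Proof.
move=> ch sm; set v := logn p m.+1.
have dv i : p ^ v %| h i by apply: no_carry_dvdn; rewrite // sm pfactor_dvdnn.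
have [i0 ndv] : exists i, ~~ (p ^ v.+1 %| h i).
  apply/existsP; rewrite -negb_forall; apply/negP => /forallP dvS.
  have := pfactor_dvdn v.+1 p_prime (ltn0Sn m).
  by rewrite ltnn -sm dvdn_sum // => i _; apply: dvS.
have hi0 : 0 < h i0 by case: (h i0) ndv; rewrite ?dvdn0.
have vi0 : logn p (h i0) = v.
  by apply/eqP; rewrite eqn_leq -ltnS ltnNge -!pfactor_dvdn // ndv dv.
pose h' i := if i == i0 then (h i).-1 else h i.
have sumE f : \sum_i f i (h' i) = f i0 (h i0).-1 + \sum_(i | i != i0) f i (h i).
  rewrite (bigD1 i0) //= /h' eqxx; congr addn.
  by apply: eq_bigr => i /negPf ->.
have sm' : \sum_i h' i = m.
  apply: succn_inj; rewrite -sm (sumE (fun _ x => x)) -addSn prednK //.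
  by rewrite [RHS](bigD1 i0).
exists h'; split => // [j|i]; last by rewrite /h'; case: ifP; rewrite ?leq_pred.
apply/eqP; rewrite sm' -(eqn_add2l (p ^ j %| m.+1)) -divnS // -sm -ch.
rewrite (sumE (fun _ x => x %/ p ^ j)) addnA [eqbRHS](bigD1 i0) //= eqn_add2r.
rewrite sm -[X in _ == X %/ _]prednK // divnS // prednK //.
by rewrite !pfactor_dvdn // vi0.
Qed.

Lemma no_carry_sub m h : no_carry h -> m <= \sum_i h i ->
  exists h', [/\ no_carry h', \sum_i h' i = m & forall i, h' i <= h i].
Proof.
move=> ch /subnK; move: (_ - m) => r; elim: r => [|r IH] in h ch *.
  by move=> e; exists h; rewrite -e.
rewrite addSn => /esym/(no_carry_pred ch)[h1 [ch1 e1 le1]].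
have [h2 [ch2 e2 le2]] := IH h1 ch1 (esym e1).
by exists h2; split=> // i; apply: leq_trans (le2 i) (le1 i).
Qed.

End NoCarry.

(** * Monomial ideals *)

Section IdealTheory.
Variable A : comNzRingType.
Implicit Types (I J S T : set A).

Lemma ideal_gen_ideal S : is_ideal (ideal_gen S).
Proof.
split=> [J [[]]//|f g Sf Sg J [idJ SJ]|r f Sf J [idJ SJ]].
  by case: (idJ) => _ + _; apply; [apply: Sf|apply: Sg].
by case: (idJ) => _ _; apply; apply: Sf.
Qed.

Lemma ideal_gen_min S I : is_ideal I -> S `<=` I -> ideal_gen S `<=` I.
Proof. exact: smallest_sub. Qed.

Lemma sub_ideal_gen S : S `<=` ideal_gen S.
Proof. exact: sub_gen_smallest. Qed.

Lemma ideal_sum I (T : eqType) (r : seq T) (F : T -> A) :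
  is_ideal I -> (forall i, i \in r -> I (F i)) -> I (\sum_(i <- r) F i).
Proof.
move=> [I0 ID _] IF; rewrite big_seq.
exact: (big_ind I).
Qed.

Lemma ideal_add_ideal I J : is_ideal I -> is_ideal J -> is_ideal (ideal_add I J).
Proof.
move=> [I0 ID IM] [J0 JD JM]; split.
- by exists 0 => //; exists 0; rewrite ?addr0.
- move=> _ _ [f1 If1 [g1 Jg1 <-]] [f2 If2 [g2 Jg2 <-]].
  by exists (f1 + f2); [apply: ID|exists (g1 + g2); [apply: JD|rewrite addrACA]].
- move=> r _ [f If [g Jg <-]].
  by exists (r * f); [apply: IM|exists (r * g); [apply: JM|rewrite mulrDr]].
Qed.

Lemma ideal_addl I J : is_ideal J -> I `<=` ideal_add I J.
Proof. by move=> [J0 _ _] f If; exists f => //; exists 0; rewrite ?addr0. Qed.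

Lemma ideal_addr I J : is_ideal I -> J `<=` ideal_add I J.
Proof. by move=> [I0 _ _] f Jf; exists 0 => //; exists f; rewrite ?add0r. Qed.

(** Extend from generators one factor at a time: for a fixed multiplier, the elements whose product
    with it lies in the right-hand ideal form an ideal. *)
Lemma ideal_mul_gen S T :
  ideal_mul (ideal_gen S) (ideal_gen T) = ideal_gen [set f * g | f in S & g in T].
Proof.
apply/seteqP; split; last first.
  apply: smallest_sub; first exact: ideal_gen_ideal.
  move=> _ [f Sf [g Tg <-]]; apply: sub_ideal_gen.
  by exists f; [exact: sub_ideal_gen|exists g => //; exact: sub_ideal_gen].
set U := ideal_gen (image2 _ _ _); have [U0 UD UM] : is_ideal U.
  exact: ideal_gen_ideal.
have genl g : T g -> ideal_gen S `<=` [set f | U (f * g)].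
  move=> Tg; apply: ideal_gen_min => [|f Sf].
    split=> [|f1 f2|r f] /=; first by rewrite mul0r.
      by rewrite mulrDl; apply: UD.
    by rewrite -mulrA; apply: UM.
  by apply: sub_ideal_gen; exists f => //; exists g.
apply: ideal_gen_min => // _ [f Sf [g Tg <-]].
have: ideal_gen T `<=` [set g | U (f * g)]; last exact.
apply: ideal_gen_min => [|h Th]; last exact: genl.
split=> [|f1 f2|r h] /=; first by rewrite mulr0.
  by rewrite mulrDr; apply: UD.
by rewrite mulrCA; apply: UM.
Qed.

End IdealTheory.

Lemma exprDXn_pchar (A : comNzRingType) p e (x y : A) : p \in [pchar A] ->
  (x + y) ^+ (p ^ e) = x ^+ (p ^ e) + y ^+ (p ^ e).
Proof.
by move=> pA; apply: exprDn_pchar; rewrite pnatX pnatE ?pA // (pcharf_prime pA).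
Qed.

Section MonomialIdeals.
Variables (k : fieldType) (n : nat).
Implicit Types (S T : set (multinom n)) (s v : multinom n) (f g : mpoly n k).

Lemma monomial_ideal_ideal S : is_ideal (monomial_ideal k S).
Proof. exact: ideal_gen_ideal. Qed.

Lemma mpolyX_monomial_ideal S s : S s -> monomial_ideal k S (mpolyX k s).
Proof.
by move=> Ss; apply: (@sub_ideal_gen _ [set mpolyX k v | v in S]); exists s.
Qed.

Lemma lem_mpolyX_monomial_ideal S s v :
  S s -> lem s v -> monomial_ideal k S (mpolyX k v).
Proof.
move=> Ss /mnm_lepP sv; have [_ _ IM] := monomial_ideal_ideal S.
have -> : v = mnm_add (mnm_sub v s) s.
  by apply/mnmP => i; rewrite mnmDE mnmBE subnK.
by rewrite mpolyXD; apply: IM; exact: mpolyX_monomial_ideal.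
Qed.

(** The condition on supports defines an ideal, since every exponent of a product is a sum of
    exponents of the factors. Later ideal computations reduce to exponents through this
    criterion. *)
Lemma in_monomial_ideal S f : monomial_ideal k S f <->
  forall v, v \in msupp f -> exists2 s, S s & lem s v.
Proof.
split; last first.
  move=> Sf; rewrite (mpolyE f); apply: ideal_sum => [|v /Sf[s Ss sv]].
    exact: monomial_ideal_ideal.
  have [_ _ IM] := monomial_ideal_ideal S.
  by rewrite -mul_mpolyC; apply: IM; exact: lem_mpolyX_monomial_ideal Ss sv.
apply: (@ideal_gen_min _ _ [set f | forall v, v \in msupp f ->
  exists2 s, S s & lem s v]) => [|_ [s Ss <-] v /=]; last first.
  by rewrite msuppX inE => /eqP ->; exists s => //; apply/mnm_lepP.
split=> [v|f1 f2 IH1 IH2 v|r g IH v] /=; first by rewrite msupp0.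
  by move/msuppD_le; rewrite mem_cat => /orP[/IH1|/IH2].
move=> /msuppM_le/allpairsP[[v1 v2] /= [_ /IH[s Ss /mnm_lepP sv2] ->]].
exists s => //; apply/mnm_lepP => i; rewrite mnmDE.
exact: leq_trans (sv2 i) (leq_addl _ _).
Qed.

Lemma in_monomial_idealX S v :
  monomial_ideal k S (mpolyX k v) <-> exists2 s, S s & lem s v.
Proof.
rewrite in_monomial_ideal; split=> [|Sv w]; first by apply; rewrite msuppX inE.
by rewrite msuppX inE => /eqP ->.
Qed.

Lemma sub_monomial_ideal S I : is_ideal I -> (forall s, S s -> I (mpolyX k s)) ->
  monomial_ideal k S `<=` I.
Proof. by move=> idI SI; apply: ideal_gen_min => // _ [s Ss <-]; apply: SI. Qed.

Lemma monomial_idealT S : S mnm0 -> monomial_ideal k S = setT.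
Proof.
move=> S0; apply/seteqP; split=> // f _; apply/in_monomial_ideal => v _.
by exists mnm0 => //; apply/mnm_lepP => i; rewrite mnm0E.
Qed.

Lemma monomial_ideal_mul S T :
  ideal_mul (monomial_ideal k S) (monomial_ideal k T) =
  monomial_ideal k [set mnm_add s t | s in S & t in T].
Proof.
rewrite /monomial_ideal ideal_mul_gen; congr ideal_gen.
apply/seteqP; split.
  move=> _ [_ [s Ss <-] [_ [t Tt <-] <-]].
  by exists (mnm_add s t); [exists s => //; exists t|rewrite mpolyXD].
move=> _ [_ [s Ss [t Tt <-]] <-]; rewrite mpolyXD.
by exists (mpolyX k s); [exists s|exists (mpolyX k t); [exists t|]].
Qed.

Lemma diag_idealE (w : 'I_n -> nat) :
  diag_ideal k w = monomial_ideal k [set mnm_muln (mnm1 i) (w i) | i in [set: 'I_n]].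
Proof.
congr ideal_gen; apply/seteqP; split=> [_ [i _ <-]|_ [_ [i _ <-] <-]].
  by exists (mnm_muln (mnm1 i) (w i)); [exists i|rewrite mpolyXn].
by exists i; rewrite // mpolyXn.
Qed.

Variable p : nat.
Hypothesis pchar_p : p \in [pchar k].

Lemma mpoly_pchar : p \in [pchar (mpoly n k)].
Proof. exact: rmorph_pchar (@mpolyC n k) _ pchar_p. Qed.

Lemma mpoly_expr_pcharE e f : f ^+ (p ^ e) =
  \sum_(v <- msupp f) mcoeff v f ^+ (p ^ e) *: mpolyX k (mnm_muln v (p ^ e)).
Proof.
rewrite {1}(mpolyE f) (big_morph (fun g => g ^+ (p ^ e)) (id1 := 0) (op1 := +%R)).
- by apply: eq_bigr => v _; rewrite exprZn mpolyXn.
- by move=> g h; apply: exprDXn_pchar mpoly_pchar.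
- by rewrite expr0n expn_eq0 -leqn0 leqNgt prime_gt0 // (pcharf_prime pchar_p).
Qed.

(** Raising to the power p ^ e is additive, so it only multiplies the exponents occurring in a
    polynomial by p ^ e. *)
Lemma frob_pow_monomial_ideal e S : frob_pow (monomial_ideal k S) (p ^ e) =
  monomial_ideal k [set mnm_muln s (p ^ e) | s in S].
Proof.
apply/seteqP; split; last first.
  apply: sub_monomial_ideal => [|_ [s Ss <-]]; first exact: ideal_gen_ideal.
  rewrite -mpolyXn; apply: sub_ideal_gen; exists (mpolyX k s) => //.
  exact: mpolyX_monomial_ideal.
apply: ideal_gen_min => [|_ [f /in_monomial_ideal Sf <-]].
  exact: monomial_ideal_ideal.
rewrite mpoly_expr_pcharE; apply: ideal_sum => [|v /Sf[s Ss /mnm_lepP sv]].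
  exact: monomial_ideal_ideal.
rewrite -mul_mpolyC; case: (monomial_ideal_ideal [set mnm_muln s (p ^ e) | s in S]).
move=> _ _; apply; apply: lem_mpolyX_monomial_ideal; first by exists s; [exact: Ss|].
by apply/mnm_lepP => i; rewrite !mulmnE leq_mul2r sv orbT.
Qed.

End MonomialIdeals.

(** * Frobenius roots *)

Section FrobeniusSplitting.
Variables (k : fieldType) (p : nat).
Hypothesis pchar_p : p \in [pchar k].

Let p_gt0 : (0 < p)%N. Proof. exact/prime_gt0/(pcharf_prime pchar_p). Qed.

(* A spanning family of k over k^p of minimal size among those containing 1 is
   a basis; the functional is the coordinate at 1. *)
Lemma frobenius_splitting : F_finite k p ->
  exists phi : k -> k, [/\ phi 1 = 1, {morph phi : x y / x + y} &
    forall a x, phi (a ^+ p * x) = a * phi x].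
Proof.
have expr0p : 0 ^+ p = 0 :> k by rewrite expr0n gtn_eqF.
have exprDp (x y : k) : (x + y) ^+ p = x ^+ p + y ^+ p.
  by have := @exprDXn_pchar k p 1 x y pchar_p; rewrite expn1.
have exprNp (x : k) : (- x) ^+ p = - x ^+ p.
  apply/eqP; by rewrite -addr_eq0 -exprDp addNr expr0p.
pose span r (b : 'I_r.+1 -> k) := b ord0 = 1 /\
  forall x, exists a : 'I_r.+1 -> k, x = \sum_i a i ^+ p * b i.
move=> [r0 [b0 b0P]].
have: exists r, `[< exists b, @span r b >].
  exists r0; apply/asboolP.
  exists (fun i => if unlift ord0 i is Some j then b0 j else 1).
  split=> [|x]; first by rewrite unlift_none.
  have [a ->] := b0P x.
  exists (fun i => if unlift ord0 i is Some j then a j else 0).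
  rewrite big_ord_recl unlift_none expr0p mul0r add0r.
  by apply: eq_bigr => i _; rewrite liftK.
case/ex_minnP => r /asboolP[b [b1 bP]] rmin.
have free c : \sum_i c i ^+ p * b i = 0 -> forall i, c i = 0.
  move=> sum0; have c0 j : j != ord0 -> c j = 0.
    case: r => [|r] in b b1 bP rmin c sum0 j *; first by rewrite ord1.
    move=> jn0; apply/eqP/negP => /negP cj.
    (* The relation expresses [b j] through the other members, and deleting it keeps 1 in the family
       because j is not the index 0: a smaller spanning family. *)
    have /rmin : `[< exists b, @span r b >]; last by rewrite ltnn.
    apply/asboolP; exists (b \o lift j); split=> [|x] /=.
      suff -> : lift j ord0 = ord0 by [].
      by apply: val_inj; rewrite /= /bump leqNgt lt0n -val_eqE in jn0 *; rewrite jn0.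
    have [a xE] := bP x; pose a' i := a i - a j / c j * c i.
    exists (a' \o lift j).
    have -> : x = \sum_i a' i ^+ p * b i.
      transitivity (x - (a j / c j) ^+ p * \sum_i c i ^+ p * b i).
        by rewrite sum0 mulr0 subr0.
      rewrite {1}xE mulr_sumr -sumrB; apply: eq_bigr => i _.
      by rewrite /a' exprDp exprNp [in RHS]exprMn mulrDl mulNr mulrA.
    rewrite (bigD1_ord j) //= /a' divfK // subrr expr0p.
    by rewrite mul0r add0r.
  move=> i; have [->|/c0//] := eqVneq i ord0.
  move: sum0; rewrite (bigD1 ord0) //= b1 mulr1 big1 => [|j /c0 ->].
    by move/eqP; rewrite addr0 expf_eq0 p_gt0 => /eqP.
  by rewrite expr0p mul0r.
have [a aP] := choice bP.
have coord x c : x = \sum_i c i ^+ p * b i -> a x = c.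
  move=> xE; apply/funext => i; apply/eqP; rewrite -subr_eq0; apply/eqP.
  apply: (free (fun i => a x i - c i)).
  rewrite (eq_bigr (fun j => a x j ^+ p * b j - c j ^+ p * b j)) => [|j _].
    by rewrite sumrB -aP -xE subrr.
  by rewrite exprDp exprNp mulrDl mulNr.
exists (a^~ ord0); split=> [|x y|c x].
- rewrite (coord 1 (fun i => (i == ord0)%:R)) //.
  rewrite (bigD1 ord0) //= big1 => [|i /negPf->].
    by rewrite expr1n b1 mulr1 addr0.
  by rewrite expr0p mul0r.
- rewrite (coord (x + y) (fun i => a x i + a y i)) // {1}(aP x) {1}(aP y).
  by rewrite -big_split /=; apply: eq_bigr => i _; rewrite exprDp mulrDl.
- rewrite (coord (c ^+ p * x) (fun i => c * a x i)) // {1}(aP x) mulr_sumr.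
  by apply: eq_bigr => i _; rewrite exprMn mulrA.
Qed.

Lemma frobenius_splitting_iter e : F_finite k p ->
  exists phi : k -> k, [/\ phi 1 = 1, {morph phi : x y / x + y} &
    forall a x, phi (a ^+ (p ^ e) * x) = a * phi x].
Proof.
move=> /frobenius_splitting[phi [phi1 phiD phiM]].
exists (iter e phi); elim: e => [|e [IH1 IHD IHM]]; first by split.
split=> [|x y|a x] /=; first by rewrite IH1.
  by rewrite IHD phiD.
by rewrite expnSr exprM exprAC IHM phiM.
Qed.

End FrobeniusSplitting.

Section CartierMap.
Variables (k : fieldType) (n p e : nat) (phi : k -> k) (r : multinom n).
Local Notation q := (p ^ e)%N.
Hypothesis pchar_p : p \in [pchar k].
Hypothesis phi1 : phi 1 = 1.
Hypothesis phiD : {morph phi : x y / x + y}.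
Hypothesis phiM : forall a x, phi (a ^+ q * x) = a * phi x.
Hypothesis lt_rq : forall i, (r i < q)%N.
Implicit Types (f g : mpoly n k) (v w : multinom n).

Let q_gt0 : (0 < q)%N.
Proof. by rewrite expn_gt0 (prime_gt0 (pcharf_prime pchar_p)). Qed.

Let phi0 : phi 0 = 0.
Proof. by apply: (addrI (phi 0)); rewrite -phiD !addr0. Qed.

Definition mnm_div v : multinom n := Multinom [tuple (v i %/ q)%N | i < n].

Definition mnm_lift w := mnm_add (mnm_muln w q) r.

(* The q^-1-linear map that extracts the coefficients of the monomials with
   exponents congruent to r modulo q. *)
Definition cartier f : mpoly n k :=
  \sum_(v <- msupp f) if v == mnm_lift (mnm_div v)
    then phi (mcoeff v f) *: mpolyX k (mnm_div v) else 0.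

Lemma mnm_lift_div w : mnm_div (mnm_lift w) = w.
Proof.
by apply/mnmP => i; rewrite mnmE mnmDE mulmnE divnMDl // divn_small // addn0.
Qed.

Lemma mcoeff_cartier f w : mcoeff w (cartier f) = phi (mcoeff (mnm_lift w) f).
Proof.
rewrite /cartier raddf_sum /=.
have termE v : mcoeff w (if v == mnm_lift (mnm_div v)
    then phi (mcoeff v f) *: mpolyX k (mnm_div v) else 0) =
    if v == mnm_lift w then phi (mcoeff v f) else 0.
  case: (v =P mnm_lift w) => [->|nv].
    by rewrite mnm_lift_div eqxx mcoeffZ mcoeffX eqxx mulr1.
  case: eqP => [vE|_]; last by rewrite mcoeff0.
  rewrite mcoeffZ mcoeffX; case: eqP => [divE|_]; last by rewrite mulr0.
  by case: nv; rewrite vE divE.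
rewrite (eq_bigr _ (fun v _ => termE v)).
have [suppw|nsuppw] := boolP (mnm_lift w \in msupp f).
  rewrite (bigD1_seq (mnm_lift w)) ?msupp_uniq //= eqxx big1 ?addr0 // => v.
  by move/negPf ->.
rewrite (memN_msupp_eq0 nsuppw) phi0 big_seq big1 // => v.
by case: eqP => // ->; rewrite (negPf nsuppw).
Qed.

Lemma cartierD f g : cartier (f + g) = cartier f + cartier g.
Proof. by apply/mpolyP => w; rewrite mcoeffD !mcoeff_cartier mcoeffD phiD. Qed.

Lemma mcoeffMX0 f v w : ~~ lem v w -> mcoeff w (f * mpolyX k v) = 0.
Proof.
move=> nvw; apply/eqP; rewrite mcoeff_eq0 (perm_mem (msuppMX _ _)).
by apply/negP => /mapP[w' _ wE]; rewrite wE lem_addr in nvw.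
Qed.

Lemma lem_lift v w : lem (mnm_muln v q) (mnm_lift w) = lem v w.
Proof.
apply/mnm_lepP/mnm_lepP => vw i; have := vw i; rewrite mnmDE !mulmnE.
  rewrite -leq_divRL // divnMDl // divn_small //; lia.
by move=> vwi; rewrite (leq_trans _ (leq_addr _ _)) // leq_mul2r vwi orbT.
Qed.

(** Both sides are additive in g because q-th powers are. For a term c x^v, the shift of exponents
    by q v becomes a shift by v, and [phiM] takes c ^+ q out as c. *)
Lemma cartierMX f g : cartier (f * g ^+ q) = cartier f * g.
Proof.
elim/mpolyind: g => [|c v g _ _ IH].
  rewrite mulr0 expr0n gtn_eqF // mulr0; apply/mpolyP => w.
  by rewrite mcoeff_cartier !mcoeff0.
rewrite exprDXn_pchar ?mpoly_pchar // !mulrDr cartierD IH; congr (_ + _).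
rewrite exprZn mpolyXn -!scalerAr; apply/mpolyP => w.
rewrite mcoeff_cartier !mcoeffZ phiM; congr (_ * _).
have [vw|nvw] := boolP (lem v w); last first.
  by rewrite !mcoeffMX0 ?lem_lift.
have -> : w = mnm_add v (mnm_sub w v).
  by apply/mnmP => i; rewrite mnmDE mnmBE subnKC //; apply/mnm_lepP.
rewrite mcoeffMX mcoeff_cartier -(mcoeffMX f (mnm_muln v q)).
congr (phi (mcoeff _ _)).
by apply/mnmP => i; rewrite /mnm_lift !(mnmDE, mulmnE) mulnDl addnA.
Qed.

Lemma cartier_frob_pow J f : is_ideal J -> frob_pow J q f -> J (cartier f).
Proof.
move=> [J0 JD JM].
(* [cartier] is only q^-1-linear; imposing the condition on all multiples of f makes [K] an
   ideal. *)
pose K : set (mpoly n k) := [set f | forall s, J (cartier (s * f))].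
suff /(_ f) : frob_pow J q `<=` K by move=> /[apply] /(_ 1); rewrite mul1r.
apply: ideal_gen_min => [|_ [g Jg <-] s]; last by rewrite cartierMX; apply: JM.
split=> [s|f1 f2 K1 K2 s|s f1 K1 t].
- rewrite mulr0; suff -> : cartier 0 = 0 by [].
  by rewrite /cartier msupp0 big_nil.
- by rewrite mulrDr cartierD; apply: JD.
- by rewrite mulrA.
Qed.

Lemma cartierX v : v = mnm_lift (mnm_div v) ->
  cartier (mpolyX k v) = mpolyX k (mnm_div v).
Proof.
by move=> vE; rewrite /cartier msuppX big_seq1 -vE eqxx mcoeffX eqxx phi1 scale1r.
Qed.

End CartierMap.

(** The ideal of divided exponents is one of the J being intersected, as q times the floor of s / q
    is at most s. Conversely, the Cartier map for the residues of s modulo q sends x^s to the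
    divided monomial and [frob_pow J q] into J, so every such J contains that monomial. *)
Lemma frob_root_monomial_ideal (k : fieldType) (n p e : nat) (S : set (multinom n)) :
  p \in [pchar k] -> F_finite k p ->
  frob_root (monomial_ideal k S) (p ^ e) =
  monomial_ideal k [set mnm_div p e s | s in S].
Proof.
move=> pchar_p kfin.
have q_gt0 : (0 < p ^ e)%N by rewrite expn_gt0 (prime_gt0 (pcharf_prime pchar_p)).
apply/seteqP; split=> [f|].
  apply; split; first exact: monomial_ideal_ideal.
  rewrite frob_pow_monomial_ideal //.
  apply: sub_monomial_ideal => [|s Ss]; first exact: monomial_ideal_ideal.
  apply/in_monomial_idealX; exists (mnm_muln (mnm_div p e s) (p ^ e)).
    by exists (mnm_div p e s) => //; exists s.
  by apply/mnm_lepP => i; rewrite mulmnE mnmE leq_divM.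
have [phi [phi1 phiD phiM]] := frobenius_splitting_iter pchar_p e kfin.
move=> f Sf J [idJ SJ]; move: f Sf.
apply: sub_monomial_ideal => // _ [s Ss <-].
pose r : multinom n := Multinom [tuple (s i %% p ^ e)%N | i < n].
have lt_r i : (r i < p ^ e)%N by rewrite mnmE ltn_mod.
rewrite -(@cartierX _ _ _ _ phi r) //; last first.
  by apply/mnmP => i; rewrite mnmDE mulmnE !mnmE -divn_eq.
by apply: cartier_frob_pow => //; apply: SJ; apply: mpolyX_monomial_ideal.
Qed.

(** * Frobenius powers of diagonal ideals *)

Section DiagonalPowers.
Variables (k : fieldType) (n p : nat) (d : 'I_n -> nat).
Hypothesis pchar_p : p \in [pchar k].
Implicit Types (h : 'I_n -> nat) (v w : multinom n).

Let p_prime : prime p. Proof. exact: pcharf_prime pchar_p. Qed.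
Let pX_gt0 e : (0 < p ^ e)%N. Proof. by rewrite expn_gt0 prime_gt0. Qed.

Let mfun h : multinom n := Multinom [tuple h i | i < n].

Lemma ideal_exp_diag m : ideal_exp (diag_ideal k d) m = monomial_ideal k
  [set v | exists h, (\sum_i h i)%N = m /\ forall i, v i = (d i * h i)%N].
Proof.
elim: m => [|m IH].
  rewrite monomial_idealT //; exists (fun=> 0%N).
  by split=> [|i]; rewrite ?big1 // muln0 mnm0E.
rewrite /ideal_exp iterS -/(ideal_exp _ m) IH diag_idealE monomial_ideal_mul.
congr monomial_ideal; apply/seteqP; split.
  move=> _ [_ [i _ <-] [v [h [hm vE]] <-]].
  exists (fun j => (j == i) + h j)%N; split=> [|j].
    by rewrite big_split /= hm -add1n -[in RHS](sum_single i 1).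
  rewrite mnmDE mulmnE mnm1E vE mulnDr eq_sym; congr addn.
  by case: eqP => [->|]; rewrite ?mul1n ?muln1 // muln0.
move=> v [h [hm vE]].
have [i hi] : exists i, (0 < h i)%N.
  apply/existsP/contraT; rewrite negb_exists => /forallP h0.
  by move: hm; rewrite big1 // => i _; move: (h0 i); case: (h i).
exists (mnm_muln (mnm1 i) (d i)); first by exists i.
pose h' j := if j == i then (h j).-1 else h j.
exists (mfun (fun j => (d j * h' j)%N)).
  exists h'; split=> [|j]; last by rewrite mnmE.
  apply: succn_inj; rewrite -hm (bigD1 i) //= [in RHS](bigD1 i) //= /h' eqxx.
  by rewrite -addSn prednK //; congr addn; apply: eq_bigr => j /negPf ->.
apply/mnmP => j; rewrite mnmDE mulmnE mnm1E mnmE vE /h' eq_sym.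
by case: eqP => [->|//]; rewrite mul1n -mulnS prednK.
Qed.

(** Induction on the number N of digits, peeling off the lowest one, at position j. A digit is below
    p, so exponents with that sum never carry; splitting each [h i] into quotient and remainder by p
    inverts the assembly. *)
Lemma frob_npow_diag_digits m N j :
  \big[@ideal_mul _/setT]_(i < N) frob_pow
    (ideal_exp (diag_ideal k d) ((m %/ p ^ (j + i)) %% p)%N) (p ^ (j + i))%N =
  monomial_ideal k [set v | exists h, [/\ no_carry p h,
    (\sum_i h i = m %/ p ^ j %% p ^ N)%N & forall i, v i = (p ^ j * (d i * h i))%N]].
Proof.
elim: N => [|N IH] in j *.
  rewrite big_ord0 monomial_idealT //; exists (fun=> 0%N); split=> [|| i].
  - by apply: no_carry_small; rewrite // big1 ?prime_gt0.
  - by rewrite big1 // modn1.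
  - by rewrite mnm0E !muln0.
rewrite big_ord_recl addn0; under eq_bigr do rewrite lift0 -addSnnS.
rewrite IH ideal_exp_diag frob_pow_monomial_ideal // monomial_ideal_mul.
have mE : (m %/ p ^ j %% p ^ N.+1)%N =
    (p * (m %/ p ^ j.+1 %% p ^ N) + m %/ p ^ j %% p)%N.
  rewrite {1}(divn_eq (m %/ p ^ j %% p ^ N.+1) p) modn_dvdm ?dvdn_exp //.
  by rewrite expnSr -modn_divl -divnMA -expnSr mulnC.
congr monomial_ideal; apply/seteqP; split.
  move=> _ [_ [v [a [am vE]] <-] [v' [h [ch hm v'E]] <-]].
  have lt_ap : (\sum_i a i < p)%N by rewrite am ltn_mod prime_gt0.
  exists (fun i => p ^ 1 * h i + a i)%N; split=> [||i].
  - by apply: no_carryD; rewrite ?expn1 //; apply: no_carry_small.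
  - by rewrite big_split /= -big_distrr /= hm am expn1 mE.
  - rewrite mnmDE mulmnE vE v'E expn1 expnS; ring.
move=> v [h [ch hm vE]].
exists (mfun (fun i => p ^ j * (d i * (h i %% p)))%N).
  exists (mfun (fun i => d i * (h i %% p))%N).
    exists (fun i => h i %% p)%N; split=> [|i]; last by rewrite mnmE.
    have := @no_carry_modn p n 1 h ch; rewrite expn1 => ->.
    by rewrite hm modn_dvdm // dvdn_exp.
  by apply/mnmP => i; rewrite mulmnE !mnmE mulnC.
exists (mfun (fun i => p ^ j.+1 * (d i * (h i %/ p)))%N).
  exists (fun i => h i %/ p ^ 1)%N; split=> [||i].
  - exact: no_carry_divn.
  - by rewrite ch hm mE expn1 mulnC divnMDl ?prime_gt0 // [X in (_ + X)%N]divn_small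
      ?addn0 // ltn_mod prime_gt0.
  - by rewrite mnmE expn1.
apply/mnmP => i; rewrite mnmDE !mnmE vE /= expnS.
have := divn_eq (h i) p; set x := (h i %/ p)%N; set y := (h i %% p)%N => ->; ring.
Qed.

Lemma frob_npow_diag m : frob_npow p (diag_ideal k d) m = monomial_ideal k
  [set v | exists h, [/\ no_carry p h, (\sum_i h i = m)%N &
                         forall i, v i = (d i * h i)%N]].
Proof.
have lt_m : (m < p ^ m.+1)%N by apply/ltnW/ltn_expl/prime_gt1.
have := frob_npow_diag_digits m m.+1 0.
rewrite expn0 divn1 modn_small // => E; rewrite /frob_npow E.
by congr monomial_ideal; apply/seteqP; split=> v [h [ch hm vE]]; exists h;
  split=> // i; rewrite vE mul1n.
Qed.

(** The combinatorial form of two facts: d^[m] is not contained in diag(w)^[p^e], and, when w = v +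
    1, x^v lies in d^[m / p^e]. *)
Definition admissible w m e : Prop := exists h : 'I_n -> nat,
  [/\ no_carry p h, (\sum_i h i = m)%N & forall i, (d i * h i < w i * p ^ e)%N].

Lemma frob_npow_diag_nsub w m e :
  ~ (frob_npow p (diag_ideal k d) m `<=` frob_pow (diag_ideal k w) (p ^ e)) <->
  admissible w m e.
Proof.
rewrite frob_npow_diag diag_idealE frob_pow_monomial_ideal //; split.
  move=> nsub; apply: contrapT => nadm; apply: nsub.
  apply: sub_monomial_ideal => [|v [h [ch hm vE]]].
    exact: monomial_ideal_ideal.
  apply/in_monomial_idealX; apply: contrapT => nle; apply: nadm.
  exists h; split=> // i; rewrite -vE ltnNge; apply/negP => le_wv; apply: nle.
  exists (mnm_muln (mnm_muln (mnm1 i) (w i)) (p ^ e)).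
    by exists (mnm_muln (mnm1 i) (w i)) => //; exists i.
  apply/mnm_lepP => j; rewrite !mulmnE mnm1E.
  by case: eqP => [<-|//]; rewrite mul1n.
move=> [h [ch hm lt_h]] sub.
have /sub/in_monomial_idealX[_ [_ [i _ <-] <-] /mnm_lepP/(_ i)] :
    monomial_ideal k [set v | exists h, [/\ no_carry p h, (\sum_i h i = m)%N &
      forall i, v i = (d i * h i)%N]] (mpolyX k (mfun (fun i => (d i * h i)%N))).
  by apply: mpolyX_monomial_ideal; exists h; split=> // i; rewrite mnmE.
by rewrite !mulmnE mnm1E eqxx mul1n mnmE leqNgt lt_h.
Qed.

Lemma in_frob_qpow_diag m e (f : mpoly n k) : F_finite k p ->
  frob_qpow p (diag_ideal k d) m e f <->
  forall v, v \in msupp f -> admissible (mnm_add v (mnm_one n)) m e.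
Proof.
move=> kfin; rewrite /frob_qpow frob_npow_diag frob_root_monomial_ideal //.
have ltE h v i : (d i * h i < mnm_add v (mnm_one n) i * p ^ e)%N =
    ((d i * h i) %/ p ^ e <= v i)%N.
  by rewrite mnmDE mnmE addn1 -ltn_divLR // ltnS.
rewrite in_monomial_ideal; split=> Sf v /Sf.
  move=> [_ [s [h [ch hm sE]] <-] /mnm_lepP sv]; exists h; split=> // i.
  by rewrite ltE -sE; have := sv i; rewrite mnmE.
move=> [h [ch hm lt_h]].
exists (mnm_div p e (mfun (fun i => (d i * h i)%N))).
  exists (mfun (fun i => (d i * h i)%N)) => //.
  by exists h; split=> // i; rewrite mnmE.
by apply/mnm_lepP => i; rewrite !mnmE -ltE.
Qed.

End DiagonalPowers.

(** * Admissible fractions m / p^e and the weighted degree *)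

Section Admissible.
Variables (n p : nat) (d : 'I_n -> nat).
Hypothesis p_prime : prime p.
Hypothesis d_gt0 : forall i, (0 < d i)%N.
Hypothesis n_gt0 : (0 < n)%N.
Implicit Types (w v : multinom n).

Let p_gt0 : (0 < p)%N. Proof. exact: prime_gt0. Qed.
Let p_gt1 : (1 < p)%N. Proof. exact: prime_gt1. Qed.
Let pX_gt0 e : (0 < p ^ e)%N. Proof. by rewrite expn_gt0 p_gt0. Qed.

Lemma admissible0 w e : (forall i, 0 < w i)%N -> admissible p d w 0 e.
Proof.
move=> w_gt0; exists (fun=> 0%N); split=> [|| i].
- by apply: no_carry_small => //; rewrite big1.
- by rewrite big1.
- by rewrite muln0 muln_gt0 w_gt0 pX_gt0.
Qed.

Lemma admissible_geq w v m e :
  (forall i, w i <= v i)%N -> admissible p d w m e -> admissible p d v m e.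
Proof.
move=> le_wv [h [ch hm lt_h]]; exists h; split=> // i.
by rewrite (leq_trans (lt_h i)) // leq_mul2r le_wv orbT.
Qed.

Lemma admissible_leq w m m' e :
  (m' <= m)%N -> admissible p d w m e -> admissible p d w m' e.
Proof.
move=> le_m [h [ch hm lt_h]]; rewrite -hm in le_m.
have [h' [ch' hm' le_h]] := no_carry_sub p_prime ch le_m.
exists h'; split=> // i; apply: leq_ltn_trans (lt_h i).
by rewrite leq_mul2l le_h orbT.
Qed.

(** Multiplying the entries by p ^ s shifts their digits. Conversely, a total divisible by p ^ s and
    formed without carries has all its entries divisible by p ^ s. Hence only the fraction m / p ^ e
    matters. *)
Lemma admissible_scale w m e s :
  admissible p d w (p ^ s * m) (s + e) <-> admissible p d w m e.
Proof.
split=> [[h [ch hm lt_h]]|[h [ch hm lt_h]]].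
  have dvd_h : forall i, (p ^ s %| h i)%N.
    by apply: no_carry_dvdn => //; rewrite hm dvdn_mulr.
  exists (fun i => h i %/ p ^ s)%N; split=> [||i].
  - exact: no_carry_divn.
  - by rewrite ch hm mulKn.
  - by rewrite -(ltn_pmul2l (pX_gt0 s)) mulnCA (mulnC _ (h i %/ _)%N) divnK //
      mulnCA -expnD.
exists (fun i => p ^ s * h i + 0)%N; split=> [||i].
- apply: no_carryD; rewrite ?big1 //.
  by apply: no_carry_small => //; rewrite big1.
- by under eq_bigr do rewrite addn0; rewrite -big_distrr /= hm.
- by rewrite addn0 mulnCA expnD (mulnCA (w i)) ltn_pmul2l.
Qed.

(* This is the right constancy of Frobenius powers. *)
Lemma admissible_succ w m e : admissible p d w m e ->
  exists s, admissible p d w (p ^ s * m).+1 (s + e).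
Proof.
(* The strict bound on [h i0] leaves a gap of at least 1, which scaling turns into p ^ s > d i0:
   room for one more unit in the entry i0. *)
move=> [h [ch hm lt_h]]; pose i0 := Ordinal n_gt0; pose s := d i0.
have lt_ds : (d i0 < p ^ s)%N by apply: ltn_expl.
exists s, (fun i => p ^ s * h i + (if i == i0 then 1 else 0))%N; split=> [||i].
- apply: no_carryD => //; first exact: no_carry_single.
  by rewrite sum_single (leq_ltn_trans _ lt_ds).
- by rewrite big_split /= sum_single -big_distrr /= hm addn1.
- have := lt_h i; rewrite -(leq_pmul2l (pX_gt0 s)) expnD mulnS (mulnCA _ (w i)).
  apply: leq_trans; rewrite mulnDr addnC mulnCA ltn_add2r.
  by case: eqP => [->|_]; rewrite ?muln1 // muln0.
Qed.

Lemma dvdn_lcm_exp i : (d i %| lcm_exp d)%N.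
Proof. by rewrite /lcm_exp (bigD1 i) //= dvdn_lcml. Qed.

Lemma lcm_exp_gt0 : (0 < lcm_exp d)%N.
Proof.
by rewrite /lcm_exp; elim/big_ind: _ => // x y; rewrite lcmn_gt0 => -> ->.
Qed.

Lemma wdegE w : wdeg d w = (\sum_i lcm_exp d %/ d i * w i)%N.
Proof. by apply: eq_bigr => i _; rewrite divn_mulAC ?dvdn_lcm_exp. Qed.

Lemma wdegD w v : wdeg d (mnm_add w v) = (wdeg d w + wdeg d v)%N.
Proof.
by rewrite !wdegE -big_split /=; apply: eq_bigr => i _; rewrite mnmDE mulnDr.
Qed.

(** Sum the strict inequalities with weights D / d_i, where D = lcm(d); this yields crit(d, w) <=
    deg(w) / D. *)
Lemma admissible_wdeg w m e : admissible p d w m e ->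
  (lcm_exp d * m < wdeg d w * p ^ e)%N.
Proof.
move=> [h [_ <- lt_h]]; rewrite wdegE big_distrr big_distrl /=.
have lt_i i : (lcm_exp d * h i < lcm_exp d %/ d i * w i * p ^ e)%N.
  rewrite -{1}(divnK (dvdn_lcm_exp i)) -!mulnA ltn_pmul2l //.
  by rewrite divn_gt0 // dvdn_leq ?dvdn_lcm_exp ?lcm_exp_gt0.
pose i0 := Ordinal n_gt0; rewrite (bigD1 i0) //= [X in (_ < X)%N](bigD1 i0) //=.
by rewrite -addSn leq_add // leq_sum // => i _; apply: ltnW.
Qed.

Section LargeCharacteristic.
Hypothesis p_large : (n * lcm_exp d - n < p)%N.
Hypothesis p_lcm : ~~ (p %| lcm_exp d)%N.

(* At the level p: either the largest exponents h allowed by w add up without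
   carry, and the bound on p controls the rounding errors, or they carry, and
   then w admits all the values p ^ j - 1. *)
Lemma admissible_dichotomy w : (forall i, 0 < w i)%N ->
  (exists c, forall j, admissible p d w (p ^ (j + c)).-1 (j + c)) \/
  (exists2 m, admissible p d w m 1 & ((wdeg d w).-1 * p <= lcm_exp d * m)%N).
Proof.
move=> w_gt0.
have [/existsP[i le_dw]|] := boolP [exists i, d i <= w i]%N.
  left; exists 0%N => j; rewrite addn0.
  exists (fun l => if l == i then (p ^ j).-1 else 0)%N; split=> [|| l].
  - exact: no_carry_single.
  - exact: sum_single.
  - case: eqP => [->|_]; last by rewrite muln0 muln_gt0 w_gt0 pX_gt0.
    by rewrite (@leq_trans (d i * p ^ j)) ?leq_mul2r ?le_dw ?orbT //
      ltn_pmul2l // prednK.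
rewrite negb_exists => /forallP lt_wd.
have {}lt_wd i : (w i < d i)%N by rewrite ltnNge lt_wd.
(* The predecessor makes this the largest a_i with the strict bound d_i a_i < w_i p. *)
pose a i := ((w i * p).-1 %/ d i)%N.
have wp_gt0 i : (0 < w i * p)%N by rewrite muln_gt0 w_gt0 p_gt0.
have le_a i : (d i * a i < w i * p)%N.
  by rewrite -[X in (_ < X)%N]prednK // ltnS mulnC leq_divM.
(* Equality would give d_i | w_i p, hence d_i | w_i as p is prime to d_i, against w_i < d_i. This
   strictness accounts for the -n in the bound on p. *)
have ge_a i : (w i * p < d i * (a i).+1)%N.
  have le_wp : (w i * p <= d i * (a i).+1)%N.
    by rewrite -(ltn_predK (wp_gt0 i)) [leqRHS]mulnC; apply: ltn_ceil.
  rewrite ltn_neqAle le_wp andbT; apply/eqP => wE.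
  have: (d i %| w i * p)%N by rewrite wE dvdn_mulr.
  rewrite Gauss_dvdl; last first.
    rewrite coprime_sym prime_coprime //; apply: contra p_lcm => /dvdn_trans.
    by apply; apply: dvdn_lcm_exp.
  by move/(dvdn_leq (w_gt0 i)); rewrite leqNgt lt_wd.
have [lt_ap|ge_ap] := ltnP (\sum_i a i)%N p.
  right; exists (\sum_i a i)%N.
    by exists a; split=> //; exact: no_carry_small.
  (* Sum D (a_i + 1) >= (D / d_i) (w_i p + 1) >= (D / d_i) w_i p + 1 over i. The total error nD - n
     is below p, the loss allowed by the predecessor of [wdeg d w]. *)
  have : (wdeg d w * p + n <= lcm_exp d * (\sum_i a i) + n * lcm_exp d)%N.
    rewrite wdegE big_distrl big_distrr /= -[n in (_ + n)%N]card_ord.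
    rewrite -sum1_card.
    rewrite -[(n * lcm_exp d)%N](_ : \sum_(i < n) lcm_exp d = _)%N; last first.
      by rewrite sum_nat_const card_ord.
    rewrite -!big_split /=; apply: leq_sum => i _.
    rewrite [leqRHS]addnC -mulnS -{2}(divnK (dvdn_lcm_exp i)) -!mulnA.
    have c_gt0 : (0 < lcm_exp d %/ d i)%N.
      by rewrite divn_gt0 // dvdn_leq ?dvdn_lcm_exp ?lcm_exp_gt0.
    rewrite (@leq_trans (lcm_exp d %/ d i * (w i * p).+1)) //.
      by rewrite mulnS addnC leq_add2r.
    by rewrite leq_mul2l ge_a orbT.
  have : (n <= n * lcm_exp d)%N by rewrite leq_pmulr // lcm_exp_gt0.
  move: p_large; rewrite -subn1 mulnBl mul1n; lia.
left; exists 1%N => j.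
(* Trim [a] to a vector [b] of total p - 1, which does not carry. Some entry i keeps a spare unit,
   and p ^ j times it leaves room for p ^ j - 1 more; the total becomes p ^ j (p - 1) + p ^ j - 1 =
   p ^ (j + 1) - 1. *)
have [b [bm le_b]] := exists_leq_sum (leq_trans (leq_pred p) ge_ap).
have [i lt_bi] : exists i, (b i < a i)%N.
  apply/existsP/contraT; rewrite negb_exists => /forallP ge_b.
  have : (\sum_i a i <= \sum_i b i)%N.
    by apply: leq_sum => l _; rewrite leqNgt ge_b.
  by rewrite bm leqNgt (leq_trans _ ge_ap) // prednK.
exists (fun l => p ^ j * b l + (if l == i then (p ^ j).-1 else 0))%N; split=> [||l].
- apply: no_carryD => //; last by rewrite sum_single prednK.
    by apply: no_carry_small => //; rewrite bm prednK.
  exact: no_carry_single.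
- rewrite big_split /= sum_single -big_distrr /= bm addn1 expnSr.
  by apply: succn_inj; rewrite -addnS !prednK ?muln_gt0 ?pX_gt0 // -mulnSr prednK.
- apply: (@leq_trans (p ^ j * (w l * p))%N); last first.
    by rewrite expnD expn1 mulnCA mulnA mulnAC.
  case: eqP => [->|_].
    apply: leq_trans (_ : p ^ j * (d i * a i).+1 <= _)%N; last first.
      by rewrite leq_mul2l le_a orbT.
    apply: (@leq_ltn_trans (d i * (p ^ j * a i))); last first.
      by rewrite mulnCA ltn_pmul2l.
    rewrite leq_mul2l; apply/orP; right.
    rewrite (@leq_trans (p ^ j * (b i).+1)%N) ?leq_mul2l ?lt_bi ?orbT //.
    by rewrite mulnS addnC leq_add2r leq_pred.
  rewrite addn0 mulnCA ltn_pmul2l //.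
  by apply: leq_ltn_trans (le_a l); rewrite leq_mul2l le_b orbT.
Qed.

End LargeCharacteristic.
End Admissible.

(** * Critical exponents *)

Section CriticalExponents.
Variables (R : realType) (k : fieldType) (n p : nat) (d : 'I_n -> nat).
Hypothesis pchar_p : p \in [pchar k].
Hypothesis d_gt0 : forall i, (0 < d i)%N.
Hypothesis n_gt0 : (0 < n)%N.
Implicit Types (w v : multinom n) (x : R).

Let p_prime : prime p. Proof. exact: pcharf_prime pchar_p. Qed.
Let pX_gt0 e : (0 < p ^ e)%N. Proof. by rewrite expn_gt0 prime_gt0. Qed.
Let pXr_gt0 e : 0 < (p ^ e)%N%:R :> R. Proof. by rewrite ltr0n. Qed.

Local Notation dd := (diag_ideal k d).
Local Notation muw w e := (mu p dd (diag_ideal k w) e).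
Local Notation critw w := (crit R p dd (diag_ideal k w)).
Local Notation admissible := (admissible p d).

Section FixedExponent.
Variable w : multinom n.
Hypothesis w_gt0 : forall i, (0 < w i)%N.

(** The default branch of [mu] is never taken: 0 is admissible and the weighted degree bounds all
    admissible values, so the maximum exists. *)
Lemma muP e :
  admissible w (muw w e) e /\ forall m, admissible w m e -> (m <= muw w e)%N.
Proof.
have nsubP m := frob_npow_diag_nsub d pchar_p w m e.
have ex_adm : exists m, `[< admissible w m e >].
  by exists 0%N; apply/asboolP; apply: admissible0.
have bounded m : `[< admissible w m e >] -> (m <= wdeg d w * p ^ e)%N.
  move=> /asboolP /(admissible_wdeg d_gt0 n_gt0)/ltnW; apply: leq_trans.
  by rewrite leq_pmull // lcm_exp_gt0.
have [m /asboolP adm_m max_m] := ex_maxnP ex_adm bounded.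
rewrite /mu; case: xgetP => [m' -> [/nsubP adm_m' max_m']|/(_ m) []].
  by split=> // m0 /nsubP/max_m'.
by split=> [|m' /nsubP adm_m']; [apply/nsubP|apply/max_m/asboolP].
Qed.

Let a e : R := padic_frac R p (muw w e) e.

Lemma padic_frac_mu_nondecreasing : nondecreasing_seq a.
Proof.
apply/nondecreasing_seqP => e.
rewrite /a /padic_frac ler_pdivrMr // mulrAC ler_pdivlMr // -!natrM ler_nat.
rewrite expnS mulnA leq_mul2r; apply/orP; right.
have [[adm_mu _] [_ max_mu]] := (muP e, muP e.+1).
apply: max_mu; have := (admissible_scale d p_prime w (muw w e) e 1).2 adm_mu.
by rewrite expn1 mulnC.
Qed.

Lemma padic_frac_mu_bounded e : a e <= (wdeg d w)%:R / (lcm_exp d)%:R.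
Proof.
have [/(admissible_wdeg d_gt0 n_gt0)/ltnW adm_mu _] := muP e.
rewrite /a /padic_frac ler_pdivrMr // mulrAC ler_pdivlMr ?ltr0n ?lcm_exp_gt0 //.
by rewrite -!natrM ler_nat mulnC.
Qed.

Lemma cvg_padic_frac_mu : cvgn a.
Proof.
apply: nondecreasing_is_cvgn padic_frac_mu_nondecreasing _.
exists ((wdeg d w)%:R / (lcm_exp d)%:R) => _ [e _ <-].
exact: padic_frac_mu_bounded.
Qed.

(** Strictness comes from [admissible_succ]: at a finer level the larger fraction (p ^ s m + 1) / p
    ^ (s + e) is still admissible, hence at most the limit. *)
Lemma admissible_crit m e : admissible w m e -> m%:R < critw w * (p ^ e)%:R.
Proof.
move=> /(admissible_succ p_prime d_gt0 n_gt0)[s adm_m].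
have [_ /(_ _ adm_m) le_mu] := muP (s + e).
have := nondecreasing_cvgn_le padic_frac_mu_nondecreasing cvg_padic_frac_mu (s + e).
rewrite -[limn a]/(critw w) /a /padic_frac ler_pdivrMr // => le_crit.
have {le_mu le_crit} : (p ^ s * m).+1%:R <= critw w * (p ^ (s + e))%:R.
  by apply: le_trans le_crit; rewrite ler_nat.
rewrite -(ltr_pM2l (pXr_gt0 s)) expnD natrM mulrCA; apply: lt_le_trans.
by rewrite -natrM ltr_nat.
Qed.

(* The supremum is not attained, whence the weak inequality on the right. *)
Lemma crit_gtP x : x < critw w <->
  exists m e, admissible w m e /\ x * (p ^ e)%:R <= m%:R.
Proof.
split=> [lt_x|[m [e [/admissible_crit lt_m le_x]]]]; last first.
  by rewrite -(ltr_pM2r (pXr_gt0 e)) (le_lt_trans le_x).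
apply: contrapT => nadm; move: lt_x; rewrite ltNge => /negP; apply.
apply: limr_le; first exact: cvg_padic_frac_mu.
apply: nearW => e; rewrite -/(a e) /a /padic_frac ler_pdivrMr // leNgt.
apply/negP => lt_x; apply: nadm.
by exists (muw w e), e; split; [have [] := muP e|exact: ltW].
Qed.

Lemma crit_ge0 : 0 <= critw w.
Proof.
rewrite leNgt; apply/negP => crit_lt0; suff : critw w < critw w by rewrite ltxx.
apply/crit_gtP; exists 0%N, 0%N; split; first exact: admissible0.
by rewrite mulr1 ltW.
Qed.

Lemma crit_le_wdeg : critw w <= (wdeg d w)%:R / (lcm_exp d)%:R.
Proof. exact: limr_le cvg_padic_frac_mu (nearW _ padic_frac_mu_bounded). Qed.

Lemma crit_gt_wdeg x : (n * lcm_exp d - n < p)%N -> ~~ (p %| lcm_exp d)%N ->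
  x < 1 -> (lcm_exp d)%:R * x <= (wdeg d w).-1%:R -> x < critw w.
Proof.
move=> p_large p_lcm x_lt1 le_x; apply/crit_gtP.
have D_gt0 : 0 < (lcm_exp d)%:R :> R by rewrite ltr0n lcm_exp_gt0.
have [[c adm_c]|[m adm_m le_m]] :=
    admissible_dichotomy p_prime d_gt0 n_gt0 p_large p_lcm w_gt0; last first.
  exists m, 1%N; split=> //; rewrite -(ler_pM2l D_gt0) mulrA expn1.
  rewrite (le_trans (_ : _ <= (wdeg d w).-1%:R * p%:R)) ?ler_wpM2r //.
  by rewrite -!natrM ler_nat.
(* With this j, 1 / p ^ (j + c) is at most 1 - x, so the fraction with numerator p ^ (j + c) - 1 is
   at least x. *)
pose j := Num.bound (1 - x)^-1.
have lt_j : (1 - x)^-1 < j%:R.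
  by apply: archi_boundP; rewrite invr_ge0 subr_ge0 ltW.
exists (p ^ (j + c)).-1, (j + c)%N; split=> //.
rewrite -subn1 natrB // lerBrDr -lerBrDl -{1}[(p ^ (j + c))%:R]mul1r -mulrBl.
rewrite -ler_pdivrMl ?subr_gt0 // mulr1 (le_trans (ltW lt_j)) // ler_nat.
by rewrite (leq_trans (leq_addr c j)) // ltnW // ltn_expl // prime_gt1.
Qed.

End FixedExponent.

Lemma crit_leq w v : (forall i, 0 < w i)%N -> (forall i, w i <= v i)%N ->
  critw w <= critw v.
Proof.
move=> w_gt0 le_wv; rewrite leNgt; apply/negP.
move=> /(crit_gtP w_gt0)[m [e [adm_m le_m]]].
suff : critw v < critw v by rewrite ltxx.
have v_gt0 i : (0 < v i)%N by apply: leq_trans (le_wv i).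
apply/crit_gtP => //; exists m, e; split=> //.
exact: admissible_geq adm_m.
Qed.

(** * Real Frobenius powers of the diagonal ideal *)

Lemma mnm_add_one_gt0 v i : (0 < mnm_add v (mnm_one n) i)%N.
Proof. by rewrite mnmDE mnmE addn1. Qed.

Hypothesis kfin : F_finite k p.

Lemma bigcup_frob_qpow x m e : approx_above p x m e ->
  \bigcup_i frob_qpow p dd (m i) (e i) =
  [set f | forall v, v \in msupp f -> x < critw (mnm_add v (mnm_one n))].
Proof.
move=> [noninc cvg_x].
have cvg_me : cvgn (fun i => padic_frac R p (m i) (e i)).
  by apply/cvg_ex; exists x.
have ge_x i : x * (p ^ e i)%:R <= (m i)%:R.
  have := nonincreasing_cvgn_ge noninc cvg_me i.
  by rewrite (cvg_lim _ cvg_x) // /padic_frac ler_pdivlMr.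
apply/seteqP; split=> [f [i _] /in_frob_qpow_diag Qf v /Qf adm|f /= If].
  apply/crit_gtP; first exact: mnm_add_one_gt0.
  by exists (m i), (e i); split=> //; apply: adm.
(* The support is finite, so a single index serves all its monomials. *)
suff : \forall i \near \oo, forall v, v \in msupp f ->
    admissible (mnm_add v (mnm_one n)) (m i) (e i).
  by move=> [i _ /(_ i (leqnn i)) adm]; exists i => //; apply/in_frob_qpow_diag.
elim: (msupp f) If => [|v s IH] If; first by apply: nearW.
have {}IH := IH (fun u us => If u (@mem_behead _ (v :: s) u us)).
have lt_x := If v (mem_head v s).
(* Passing through the midpoint makes m0 / p ^ e0 strictly larger than x, so the sequence eventually
   drops below it. *)
have [lt_xm /crit_gtP[|m0 [e0 [adm0 le_m0]]]] := midf_lt lt_x.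
  exact: mnm_add_one_gt0.
have lt_m0 : x < m0%:R / (p ^ e0)%:R.
  by rewrite (lt_le_trans lt_xm) // ler_pdivlMr.
near=> i => u; rewrite inE => /orP[/eqP ->|]; last first.
  by move: u; near: i.
apply/(admissible_scale d p_prime _ _ _ e0).
apply: (@admissible_leq _ _ _ p_prime _ (p ^ e i * m0)); last first.
  by rewrite addnC; apply/admissible_scale.
have : padic_frac R p (m i) (e i) < m0%:R / (p ^ e0)%:R.
  by near: i; apply: cvgr_lt cvg_x _ lt_m0.
rewrite /padic_frac ltr_pdivrMr // mulrAC ltr_pdivlMr // -!natrM ltr_nat.
by move/ltnW; rewrite mulnC [leqRHS]mulnC.
Unshelve. all: by end_near.
Qed.

(** Take floor(x p^e) + 1 over p^e. Without such a sequence the condition defining [frob_rpow] would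
    be vacuous and would not determine the ideal. *)
Lemma approx_above_exists x : 0 <= x -> exists m e, approx_above p x m e.
Proof.
move=> x_ge0; pose m e := (Num.trunc (x * (p ^ e)%:R)).+1.
have x_pX e : 0 <= x * (p ^ e)%:R by rewrite mulr_ge0.
have le_m e : x <= padic_frac R p (m e) e.
  by rewrite ler_pdivlMr // ltW // truncnS_gt.
exists m, id; split.
  apply/nonincreasing_seqP => e.
  rewrite /padic_frac ler_pdivrMr // mulrAC ler_pdivlMr // -!natrM ler_nat.
  rewrite expnSr mulnA mulnAC leq_mul2r; apply/orP; right.
  rewrite truncn_lt_nat // expnSr !natrM mulrA ltr_pM2r ?truncnS_gt //.
  by rewrite ltr0n prime_gt0.
apply: (@squeeze_cvgr _ _ _ _ (cst x) (fun e => x + e.+1%:R^-1)).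
- apply: nearW => e; rewrite le_m /= ler_pdivrMr // mulrDl -[leLHS]natr1.
  apply: lerD; first by rewrite truncn_le.
  rewrite -[leLHS](mulVf (lt0r_neq0 (ltr0Sn R e))) ler_pM2l ?invr_gt0 //.
  by rewrite ler_nat ltn_expl // prime_gt1.
- exact: cvg_cst.
- by rewrite -[X in _ --> X]addr0; apply: cvgD; [exact: cvg_cst|exact: cvg_harmonic].
Qed.

Lemma frob_rpow_diag x : 0 <= x -> frob_rpow p dd x =
  [set f | forall v, v \in msupp f -> x < critw (mnm_add v (mnm_one n))].
Proof.
move=> x_ge0; rewrite /frob_rpow; set P := [set I | _].
have : P (xget set0 P).
  apply: xgetPex; exists [set f | forall v, v \in msupp f ->
    x < critw (mnm_add v (mnm_one n))].
  by move=> m e /bigcup_frob_qpow ->.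
(* Any one admissible sequence identifies the value chosen by [xget]. *)
have [m [e xme]] := approx_above_exists x_ge0.
by move/(_ m e xme) ->; apply: bigcup_frob_qpow.
Qed.

End CriticalExponents.

(** * The Frobenius power at a critical exponent below 1 *)

Theorem theorem5p8 (R : realType) (p : nat) (k : fieldType) (n : nat)
    (d : 'I_n -> nat) (u : mpoly.multinom n) :
  p \in [pchar k] -> F_finite k p -> (0 < n)%N ->
  (forall i, 0 < d i)%N ->
  (n * lcm_exp d - n < p)%N -> ~~ (p %| lcm_exp d)%N ->
  (forall i, 0 < u i)%N ->
  let dd := diag_ideal k d in
  let lambda : R := crit R p dd (diag_ideal k u) in
  lambda < 1 ->
  let calA := [set v : mpoly.multinom n |
    crit R p dd (diag_ideal k (mpoly.mnm_add v (mnm_one n))) > lambda /\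
    wdeg d (mpoly.mnm_add v (mnm_one n)) = wdeg d u] in
  frob_rpow p dd lambda =
    ideal_add (R_gt k d (wdeg d (mpoly.mnm_sub u (mnm_one n))))
              (monomial_ideal k calA).
Proof.
move=> pchar_p kfin n_gt0 d_gt0 p_large p_lcm u_gt0 dd lambda lambda_lt1 calA.
have D_gt0 : 0 < (lcm_exp d)%:R :> R by rewrite ltr0n lcm_exp_gt0.
have pos1 := @mnm_add_one_gt0 n.
(* D x <= D crit(d, w) <= deg(w) <= deg(w') - 1, as weighted degrees are integers. *)
have key (w w' : multinom n) : (forall i, 0 < w' i)%N -> (forall i, 0 < w i)%N ->
    (wdeg d w < wdeg d w')%N -> forall x : R, x < 1 ->
    x <= crit R p dd (diag_ideal k w) -> x < crit R p dd (diag_ideal k w').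
  move=> w'_gt0 w_gt0 lt_ww' x x_lt1 le_x; apply: crit_gt_wdeg => //.
  rewrite mulrC -ler_pdivlMr // (le_trans le_x) //.
  apply: le_trans (crit_le_wdeg R pchar_p d_gt0 n_gt0 w_gt0) _.
  by rewrite ler_pM2r ?invr_gt0 // ler_nat -ltnS (ltn_predK lt_ww').
(* If deg(v + 1) < deg(u), then [key] with x = lambda yields lambda < crit(d, u) = lambda. *)
have crit_deg v : lambda < crit R p dd (diag_ideal k (mnm_add v (mnm_one n))) ->
    (wdeg d u <= wdeg d (mnm_add v (mnm_one n)))%N.
  move=> lt_v; rewrite leqNgt; apply/negP => lt_deg.
  have : lambda < lambda by apply: key lt_deg _ _ _ => //; exact: ltW.
  by rewrite ltxx.
have degE v : (wdeg d (mnm_sub u (mnm_one n)) < wdeg d v)%N =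
    (wdeg d u < wdeg d (mnm_add v (mnm_one n)))%N.
  (* The truncated subtraction is exact because u has positive entries. *)
  have uE : u = mnm_add (mnm_sub u (mnm_one n)) (mnm_one n).
    by apply/mnmP => i; rewrite mnmDE mnmBE mnmE subnK.
  by rewrite {2}uE !wdegD // ltn_add2r.
rewrite frob_rpow_diag //; last exact: crit_ge0.
apply/seteqP; split=> [f /= If|_ [f Gf [g Ag <-]] v].
  have idG := monomial_ideal_ideal k
    [set v | (wdeg d (mnm_sub u (mnm_one n)) < wdeg d v)%N].
  have idA := monomial_ideal_ideal k calA.
  rewrite (mpolyE f); apply: ideal_sum => [|v /If lt_v].
    exact: ideal_add_ideal.
  have [_ _ IM] := ideal_add_ideal idG idA; rewrite -mul_mpolyC; apply: IM.
  (* Equal degrees put v in [calA]; a larger degree puts x^v in the first ideal. *)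
  have := crit_deg v lt_v; rewrite leq_eqVlt => /orP[/eqP eq_deg|lt_deg].
    by apply: ideal_addr => //; apply: mpolyX_monomial_ideal.
  apply: ideal_addl => //; apply: mpolyX_monomial_ideal.
  by rewrite /= degE.
have crit_geq s : lem s v ->
    crit R p dd (diag_ideal k (mnm_add s (mnm_one n))) <=
    crit R p dd (diag_ideal k (mnm_add v (mnm_one n))).
  move=> /mnm_lepP le_sv; apply: crit_leq => // i.
  by rewrite !mnmDE leq_add2r.
move/msuppD_le; rewrite mem_cat => /orP[vf|vg].
  have [s /= lt_s le_sv] := (in_monomial_ideal _ _).1 Gf v vf.
  apply: lt_le_trans (crit_geq s le_sv); rewrite degE in lt_s.
  exact: key lt_s _ _ _.
have [s [lt_s _] le_sv] := (in_monomial_ideal _ _).1 Ag v vg.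
exact: lt_le_trans (crit_geq s le_sv).
Qed.
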